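(* Let $\mathbb{K}$ be an algebraically closed field of characteristic zero and let $\mathcal{A}=(V,m)$ be a weak totally associative ternary algebra over $\mathbb{K}$. For $p\ge 1$ let $\delta^p:\mathrm{Hom}(V^{\otimes 2p-1},V)\to\mathrm{Hom}(V^{\otimes 2p+1},V)$ be defined by $$\begin{aligned}\delta^p f(x_1\otimes\cdots\otimes x_{2p+1})={}&m(x_1\otimes x_2\otimes f(x_3\otimes\cdots\otimes x_{2p+1}))\\&+\sum_{i=1}^{p}(-1)^i f(x_1\otimes\cdots\otimes m(x_{2i-1}\otimes x_{2i}\otimes x_{2i+1})\otimes\cdots\otimes x_{2p+1})\\&+(-1)^{p+1}m(f(x_1\otimes\cdots\otimes x_{2p-1})\otimes x_{2p}\otimes x_{2p+1}).\end{aligned}$$ Then $\delta^{p+1}\circ\delta^p=0$ for all $p\ge 1$.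
   Context: A weak totally associative ternary algebra is a $\mathbb{K}$-vector space $V$ with a linear map $m:V^{\otimes 3}\to V$ such that for all $x_1,\dots,x_5\in V$, $$m(m(x_1\otimes x_2\otimes x_3)\otimes x_4\otimes x_5)=m(x_1\otimes x_2\otimes m(x_3\otimes x_4\otimes x_5)).$$ For $p\ge 1$, a $(p-1)$-cochain is a linear map $f:V^{\otimes 2p-1}\to V$. *)

(* Defs.v *)
From HB Require Import structures.
From mathcomp Require Import all_boot.
From mathcomp Require Import ssralg generic_quotient ring_quotient.
From mathcomp Require Import boolp zify.
From mathcomp.multinomials Require Import freeg.

Set Implicit Arguments.
Unset Strict Implicit.
Unset Printing Implicit Defensive.

Import GRing.Theory.
Local Open Scope ring_scope.
Local Open Scope quotient_scope.

Definition upd (V : Type) n (x : n.-tuple V) (i : 'I_n) (u : V) : n.-tuple V :=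
  [tuple if j == i then u else tnth x j | j < n].

Definition multilinear (K : fieldType) (V W : lmodType K) n
    (g : n.-tuple V -> W) : Prop :=
  forall x i a u v,
    g (upd x i (a *: u + v)) = a *: g (upd x i u) + g (upd x i v).

(* V^{(x) n} is the free K-module on n-tuples of vectors, modulo the
   subspace spanned by the multilinearity relations. *)
Section TensorPower.
Variables (K : fieldType) (V : lmodType K) (n : nat).

Local Notation free := {freeg (n.-tuple V) / K}.

Definition multilin_rel (x : n.-tuple V) (i : 'I_n) (a : K) (u v : V) : free :=
  << upd x i (a *: u + v) >> - a *: << upd x i u >> - << upd x i v >>.

Inductive rel_span : free -> Prop :=
| rel_span0 : rel_span 0
| rel_spanD c x i a u v r :
    rel_span r -> rel_span (c *: multilin_rel x i a u v + r).

Definition tensor_rel : {pred free} := fun r => `[< rel_span r >].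

Lemma rel_span_lin c r s : rel_span r -> rel_span s -> rel_span (c *: r + s).
Proof.
move=> hr hs; elim: hr => [|d x i a u v r' _ IH].
  by rewrite scaler0 add0r.
by rewrite scalerDr scalerA -addrA; apply: rel_spanD.
Qed.

Lemma tensor_rel_zmod : zmod_closed tensor_rel.
Proof.
split=> [|r s /asboolP hr /asboolP hs]; apply/asboolP; first exact: rel_span0.
by rewrite addrC -scaleN1r; apply: rel_span_lin.
Qed.

HB.instance Definition _ := GRing.isZmodClosed.Build free tensor_rel
  tensor_rel_zmod.

Definition tpow : Type := Quotient.quot tensor_rel.

HB.instance Definition _ := GRing.Zmodule.on tpow.
HB.instance Definition _ : EqQuotient free (Quotient.equiv tensor_rel) tpow :=
  EqQuotient.on tpow.

Local Notation cls := (\pi_tpow : free -> tpow).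

Lemma clsD r s : cls (r + s) = cls r + cls s.
Proof. exact: Quotient.pi_add. Qed.

Lemma cls0 : cls 0 = 0.
Proof. by apply: (@addrI _ (cls 0)); rewrite -clsD !addr0. Qed.

Lemma cls_eqP r s : reflect (cls r = cls s) (r - s \in tensor_rel).
Proof. by rewrite Quotient.idealrBE; apply: eqP. Qed.

Definition tscale (c : K) (t : tpow) : tpow := cls (c *: repr t).

Lemma clsZ c r : tscale c (cls r) = cls (c *: r).
Proof.
apply/cls_eqP; rewrite -scalerBr; apply/asboolP.
rewrite -[X in rel_span X]addr0; apply: rel_span_lin; last exact: rel_span0.
by apply/(@asboolP (rel_span _))/cls_eqP; rewrite reprK.
Qed.

Lemma tscaleA a b t : tscale a (tscale b t) = tscale (a * b) t.
Proof. by rewrite -[t]reprK [tscale b _]clsZ !clsZ scalerA. Qed.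

Lemma tscale1 : left_id 1 tscale.
Proof. by move=> t; rewrite -[t]reprK clsZ scale1r. Qed.

Lemma tscaleDr : right_distributive tscale +%R.
Proof. by move=> a s t; rewrite -[s]reprK -[t]reprK -clsD !clsZ scalerDr clsD. Qed.

Lemma tscaleDl t : {morph tscale^~ t : a b / a + b}.
Proof. by move=> a b; rewrite -[t]reprK !clsZ scalerDl clsD. Qed.

HB.instance Definition _ := GRing.Zmodule_isLmodule.Build K tpow
  tscaleA tscale1 tscaleDr tscaleDl.

Lemma scale_cls c r : c *: cls r = cls (c *: r).
Proof. exact: clsZ. Qed.

Definition pure (x : n.-tuple V) : tpow := cls << x >>.

(* x_1 (x) ... (x) x_n for the list [:: x_1; ...; x_n].  It is only meant for
   lists of length n; others are truncated or padded with zero vectors. *)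
Definition tensor (s : seq V) : tpow := pure [tuple s`_i | i < n].

End TensorPower.

Section TensorTheory.
Variables (K : fieldType) (V W : lmodType K) (n : nat).

Local Notation free := {freeg (n.-tuple V) / K}.
Local Notation cls := (\pi_(tpow V n) : free -> tpow V n).

Lemma pure_multilinear : multilinear (@pure K V n).
Proof.
move=> x i a u v; rewrite scale_cls -clsD; apply/cls_eqP/asboolP.
rewrite opprD addrA.
rewrite -[X in rel_span X]addr0 -[X in rel_span (X + _)]scale1r.
exact/rel_spanD/rel_span0.
Qed.

Lemma fglift_linear (g : n.-tuple V -> W) : linear (fglift g : free -> W).
Proof.
have hB := lift_is_additive g.
have h0 : fglift g 0 = 0 by rewrite -(subrr 0) hB subrr.
have hN r : fglift g (- r) = - fglift g r by rewrite -[- r]sub0r hB h0 sub0r.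
have hD r s : fglift g (r + s) = fglift g r + fglift g s.
  by rewrite -{1}[s]opprK hB hN opprK.
have hS I (l : seq I) (F : I -> free) :
    fglift g (\sum_(i <- l) F i) = \sum_(i <- l) fglift g (F i).
  by elim/big_rec2: _ => [|i y1 y2 _ <-]; rewrite ?h0 ?hD.
move=> c r s; rewrite hD; congr (_ + _).
rewrite -[in RHS](freeg_sumE r) hS scaler_sumr [c *: r]/(fgscale c r) /fgscale hS.
by apply: eq_bigr => x _; rewrite !liftU scalerA.
Qed.

HB.instance Definition _ (g : n.-tuple V -> W) :=
  GRing.isLinear.Build K free W _ (fglift g) (fglift_linear g).

(* The linear map on V^{(x) n} induced by a multilinear map of n arguments;
   the zero map when g is not multilinear. *)
Definition tlift (g : n.-tuple V -> W) (t : tpow V n) : W :=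
  if `[< multilinear g >] then fglift g (repr t) else 0.

Lemma tlift_cls g r : multilinear g -> tlift g (cls r) = fglift g r.
Proof.
move=> hg; rewrite /tlift asboolT //; apply/eqP; rewrite -subr_eq0 -raddfB /=.
have: repr (cls r) - r \in @tensor_rel K V n by apply/cls_eqP; rewrite reprK.
move=> /asboolP; elim=> [|c x i a u v s _ IH]; first by rewrite raddf0.
rewrite linearP /= (eqP IH) addr0.
have -> : fglift g (multilin_rel x i a u v) = 0; last by rewrite scaler0.
by rewrite !linearB linearZ /= !liftU !scale1r hg -addrA -opprD subrr.
Qed.

Lemma tlift_linear g : linear (tlift g).
Proof.
move=> a s t; have [hg|hg] := pselect (multilinear g); last first.
  by rewrite /tlift asboolF // scaler0 addr0.
by rewrite -[s]reprK -[t]reprK scale_cls -clsD !tlift_cls // linearP.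
Qed.

HB.instance Definition _ g :=
  GRing.isLinear.Build K (tpow V n) W _ (tlift g) (tlift_linear g).

Lemma tlift_pure g x : multilinear g -> tlift g (pure x) = g x.
Proof. by move=> hg; rewrite tlift_cls // liftU scale1r. Qed.

Lemma tpow_ext (f g : {linear tpow V n -> W}) :
  (forall x, f (pure x) = g (pure x)) -> f =1 g.
Proof.
move=> h t; rewrite -[t]reprK -[repr t]freeg_sumE.
have hS (l : seq (n.-tuple V)) (F : n.-tuple V -> free) :
    cls (\sum_(i <- l) F i) = \sum_(i <- l) cls (F i).
  exact: (big_morph cls (@clsD K V n) (@cls0 K V n)).
rewrite hS !raddf_sum; apply: eq_bigr => x _.
have -> : cls << coeff x (repr t) *g x >> = coeff x (repr t) *: pure x.
  rewrite scale_cls; congr (cls _); apply/eqP/freeg_eqP => y.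
  by rewrite coeffZ !coeffU mul1r.
by rewrite /= !linearZ /= h.
Qed.

End TensorTheory.

Section SeqTensor.
Variables (K : fieldType) (V : lmodType K).
Implicit Types (s : seq V) (u v : V).

Lemma pureE n (x : n.-tuple V) : pure x = tensor n x.
Proof.
congr pure; apply: eq_from_tnth => i.
by rewrite tnth_mktuple -tnth_nth.
Qed.

Lemma eq_tensor n s1 s2 :
  (forall i, (i < n)%N -> s1`_i = s2`_i) -> tensor n s1 = tensor n s2.
Proof.
move=> h; congr pure; apply: eq_from_tnth => i.
by rewrite !tnth_mktuple h.
Qed.

Lemma nth_upd n (x : n.-tuple V) (i : 'I_n) u j :
  (upd x i u : seq V)`_j = (set_nth 0 x i u)`_j.
Proof.
have [ltjn|lenj] := ltnP j n; last first.
  rewrite nth_default ?size_tuple // nth_set_nth /= gtn_eqF.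
    by rewrite nth_default ?size_tuple.
  exact: leq_trans lenj.
rewrite (_ : j = Ordinal ltjn) // -tnth_nth tnth_mktuple nth_set_nth /=.
by rewrite (tnth_nth 0) -val_eqE.
Qed.

Lemma upd_seq n (x : n.-tuple V) (i : 'I_n) u :
  upd x i u = take i x ++ u :: drop i.+1 x :> seq V.
Proof.
have lei : (i <= size x)%N by rewrite size_tuple ltnW.
apply: (@eq_from_nth _ 0) => [|j _].
  rewrite size_tuple size_cat /= size_drop size_takel // size_tuple.
  by have := ltn_ord i; lia.
rewrite nth_upd nth_set_nth /= nth_cat size_takel //.
case: ltngtP => [lt|gt|->]; [by rewrite nth_take | | by rewrite subnn].
by rewrite -(subnSK gt) /= nth_drop subnKC.
Qed.

Lemma tensorP n s k a u v : (k < n)%N ->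
  tensor n (set_nth 0 s k (a *: u + v)) =
    a *: tensor n (set_nth 0 s k u) + tensor n (set_nth 0 s k v).
Proof.
move=> ltkn.
have E w : tensor n (set_nth 0 s k w) =
    pure (upd [tuple s`_i | i < n] (Ordinal ltkn) w).
  congr pure; apply: eq_from_tnth => i; rewrite !tnth_mktuple nth_set_nth /=.
  by rewrite -val_eqE.
by rewrite !E; apply: pure_multilinear.
Qed.

Lemma tensor_cat_lin n s1 s2 a u v : (size s1 < n)%N ->
  tensor n (s1 ++ (a *: u + v) :: s2) =
    a *: tensor n (s1 ++ u :: s2) + tensor n (s1 ++ v :: s2).
Proof.
move=> lt1n; have E w : tensor n (s1 ++ w :: s2) =
    tensor n (set_nth 0 (s1 ++ 0 :: s2) (size s1) w).
  apply: eq_tensor => i _; rewrite nth_set_nth /= !nth_cat.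
  by case: ltngtP => // [lt1i|->]; rewrite ?subnn // -(subnSK lt1i).
by rewrite !E tensorP.
Qed.

End SeqTensor.

Section Cohomology.
Variables (K : fieldType) (V : lmodType K).

Definition weak_totally_associative (m : {linear tpow V 3 -> V}) : Prop :=
  forall x1 x2 x3 x4 x5 : V,
    m (tensor 3 [:: m (tensor 3 [:: x1; x2; x3]); x4; x5]) =
    m (tensor 3 [:: x1; x2; m (tensor 3 [:: x3; x4; x5])]).

(* For p >= 1 these are the (p-1)-cochains; p = 0 is a junk value. *)
Definition cochain (p : nat) : Type := {linear tpow V p.*2.-1 -> V}.

Variable m : {linear tpow V 3 -> V}.

(* The value of delta^p f at x_1 (x) ... (x) x_{2p+1}, where
   s = [:: x_1; ...; x_{2p+1}].  The summation index is shifted by one: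
   the term of index i is the one of index i+1 in the usual formula, so that
   m is applied to x_{2i+1} (x) x_{2i+2} (x) x_{2i+3}. *)
Definition delta_val p (f : cochain p) (s : seq V) : V :=
  let T := @tensor K V p.*2.-1 in
  m (tensor 3 (rcons (take 2 s) (f (T (drop 2 s)))))
  + \sum_(i < p) (-1) ^+ i.+1 *:
      f (T (take i.*2 s ++
            m (tensor 3 (take 3 (drop i.*2 s))) :: drop i.*2.+3 s))
  + (-1) ^+ p.+1 *:
      m (tensor 3 (f (T (take p.*2.-1 s)) :: drop p.*2.-1 s)).

Definition delta p (f : cochain p) : cochain p.+1 :=
  tlift (fun x : (p.+1.*2.-1).-tuple V => delta_val f x).

Lemma lin_comp (W1 W2 : lmodType K) (g : {linear W1 -> W2}) (h : V -> W1) :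
  linear h -> linear (fun w => g (h w)).
Proof. by move=> hh a u v; rewrite hh linearP. Qed.

Lemma dropl_cat (T : Type) j (s1 s2 : seq T) : (j <= size s1)%N ->
  drop j (s1 ++ s2) = drop j s1 ++ s2.
Proof. by elim: s1 j => [|x s1 IH] [|j] //=; [rewrite drop0 | move=> /IH]. Qed.

Lemma delta_val_lin p (f : cochain p) (s1 s2 : seq V) :
  (0 < p)%N -> (size s1 + size s2 = p.*2)%N ->
  linear (fun w : V => delta_val f (s1 ++ w :: s2)).
Proof.
move=> p_gt0 sz.
have lin1 : linear (fun w : V => m (tensor 3 (rcons (take 2 (s1 ++ w :: s2))
    (f (tensor p.*2.-1 (drop 2 (s1 ++ w :: s2))))))).
  apply: lin_comp => a u v; have [lt2|ge2] := ltnP (size s1) 2.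
    have D (w : V) : drop 2 (s1 ++ w :: s2) = drop (1 - size s1) s2.
      rewrite drop_cat ltnNge ltnW //=.
      by rewrite (_ : 2 - size s1 = (1 - size s1).+1)%N //; lia.
    have T (w : V) : take 2 (s1 ++ w :: s2) = s1 ++ w :: take (1 - size s1) s2.
      rewrite take_cat ltnNge ltnW //=.
      by rewrite (_ : 2 - size s1 = (1 - size s1).+1)%N //; lia.
    rewrite !D !T !rcons_cat /=; apply: tensor_cat_lin; lia.
  have D (w : V) : drop 2 (s1 ++ w :: s2) = drop 2 s1 ++ w :: s2.
    exact: dropl_cat.
  have T (w : V) : take 2 (s1 ++ w :: s2) = take 2 s1 by rewrite takel_cat.
  rewrite !D !T tensor_cat_lin ?size_drop; last by lia.
  by rewrite linearP -!cats1 tensor_cat_lin // size_takel.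
have lin3 : linear (fun w : V => m (tensor 3
    (f (tensor p.*2.-1 (take p.*2.-1 (s1 ++ w :: s2)))
       :: drop p.*2.-1 (s1 ++ w :: s2)))).
  apply: lin_comp => a u v; have [lt|ge] := ltnP (size s1) p.*2.-1.
    have D (w : V) : drop p.*2.-1 (s1 ++ w :: s2) = drop (p.*2.-2 - size s1) s2.
      rewrite drop_cat ltnNge ltnW //=.
      by rewrite (_ : p.*2.-1 - size s1 = (p.*2.-2 - size s1).+1)%N //; lia.
    have T (w : V) : take p.*2.-1 (s1 ++ w :: s2) =
        s1 ++ w :: take (p.*2.-2 - size s1) s2.
      rewrite take_cat ltnNge ltnW //=.
      by rewrite (_ : p.*2.-1 - size s1 = (p.*2.-2 - size s1).+1)%N //; lia.
    rewrite !D !T tensor_cat_lin // linearP.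
    exact: (@tensor_cat_lin _ _ 3 [::]).
  have D (w : V) : drop p.*2.-1 (s1 ++ w :: s2) = drop p.*2.-1 s1 ++ w :: s2.
    exact: dropl_cat.
  have T (w : V) : take p.*2.-1 (s1 ++ w :: s2) = take p.*2.-1 s1.
    by rewrite takel_cat.
  rewrite !D !T -!cat_cons; apply: tensor_cat_lin.
  by rewrite /= size_drop; lia.
have lin2 (i : 'I_p) : linear (fun w : V => f (tensor p.*2.-1
    (take i.*2 (s1 ++ w :: s2) ++
      m (tensor 3 (take 3 (drop i.*2 (s1 ++ w :: s2))))
      :: drop i.*2.+3 (s1 ++ w :: s2)))).
  have ltip := ltn_ord i.
  apply: lin_comp => a u v; have [lt|ge] := ltnP (size s1) i.*2.
    have D j (w : V) : (size s1 < j)%N ->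
        drop j (s1 ++ w :: s2) = drop (j.-1 - size s1) s2.
      move=> ltj; rewrite drop_cat ltnNge ltnW //=.
      by rewrite (_ : j - size s1 = (j.-1 - size s1).+1)%N //; lia.
    have T (w : V) : take i.*2 (s1 ++ w :: s2) =
        s1 ++ w :: take (i.*2.-1 - size s1) s2.
      rewrite take_cat ltnNge ltnW //=.
      by rewrite (_ : i.*2 - size s1 = (i.*2.-1 - size s1).+1)%N //; lia.
    have lt3 : (size s1 < i.*2.+3)%N by lia.
    rewrite !(D _ _ lt) !(D _ _ lt3) !T -!catA /=.
    by apply: tensor_cat_lin; lia.
  have D (w : V) : drop i.*2 (s1 ++ w :: s2) = drop i.*2 s1 ++ w :: s2.
    exact: dropl_cat.
  have T (w : V) : take i.*2 (s1 ++ w :: s2) = take i.*2 s1 by rewrite takel_cat.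
  rewrite !T; have [lt3|ge3] := ltnP (size s1) i.*2.+3.
    have D3 (w : V) : drop i.*2.+3 (s1 ++ w :: s2) = drop (i.*2.+2 - size s1) s2.
      rewrite drop_cat ltnNge ltnW //=.
      by rewrite (_ : i.*2.+3 - size s1 = (i.*2.+2 - size s1).+1)%N //; lia.
    have T3 (w : V) : take 3 (drop i.*2 (s1 ++ w :: s2)) =
        drop i.*2 s1 ++ w :: take (2 - size (drop i.*2 s1)) s2.
      rewrite D take_cat size_drop ltnNge ifF; last by apply/negbTE/negPn; lia.
      by rewrite (_ : 3 - (size s1 - i.*2) = (2 - (size s1 - i.*2)).+1)%N //; lia.
    rewrite !T3 !D3 tensor_cat_lin ?size_drop; last by lia.
    by rewrite linearP tensor_cat_lin // size_takel //; lia.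
  have D3 (w : V) : drop i.*2.+3 (s1 ++ w :: s2) = drop i.*2.+3 s1 ++ w :: s2.
    exact: dropl_cat.
  have T3 (w : V) : take 3 (drop i.*2 (s1 ++ w :: s2)) = take 3 (drop i.*2 s1).
    by rewrite D takel_cat // size_drop; lia.
  rewrite !T3 !D3 -!cat_cons !catA; apply: tensor_cat_lin.
  by rewrite size_cat /= size_takel // size_drop; lia.
have linS (F : 'I_p -> V -> V) : (forall i, linear (F i)) ->
    linear (fun w => \sum_(i < p) (-1) ^+ i.+1 *: F i w).
  move=> hF a u v; rewrite scaler_sumr -big_split; apply: eq_bigr => i _ /=.
  by rewrite hF scalerDr !scalerA mulrC.
move=> a u v; rewrite /delta_val lin1 lin3 (linS _ lin2) !scalerDr.
rewrite (scalerA _ a) (mulrC _ a) -scalerA.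
by rewrite [LHS](AC (2*2*2) ((1*3*5)*(2*4*6))).
Qed.

Lemma delta_val_multilinear p (f : cochain p) : (0 < p)%N ->
  multilinear (fun x : (p.+1.*2.-1).-tuple V => delta_val f x).
Proof.
move=> p_gt0; move En: p.+1.*2.-1 => n x i a u v.
rewrite !upd_seq; apply: delta_val_lin => //.
rewrite size_drop size_takel !size_tuple ?(ltnW (ltn_ord i)) //.
by have := ltn_ord i; lia.
Qed.

Lemma delta_tensor p (f : cochain p) (s : seq V) :
  (0 < p)%N -> size s = p.*2.+1 ->
  delta f (tensor p.*2.+1 s) = delta_val f s.
Proof.
move=> p_gt0 sz; rewrite /delta /= tlift_pure; last exact: delta_val_multilinear.
congr delta_val; apply: (@eq_from_nth _ 0); rewrite size_tuple // => i lti.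
by rewrite -[i]/(val (Ordinal lti)) -tnth_nth tnth_mktuple.
Qed.

End Cohomology.

(* Main.v *)
(** The value of [delta f] is an alternating sum of cofaces [coface p f j],
    0 <= j <= p+1: the outer ones multiply by [m] on the left or on the right,
    the inner ones contract three consecutive arguments.  Weak total
    associativity is what makes the cosimplicial identities
    d_j d_i = d_i d_(j-1) (i < j) hold when the two operations overlap, and
    these identities cancel the terms of the double sum in pairs. *)
Require Import Defs.
From mathcomp Require Import all_boot.
From mathcomp Require Import ssralg.
From mathcomp Require Import zify.

Set Implicit Arguments.
Unset Strict Implicit.
Unset Printing Implicit Defensive.

Import GRing.Theory.
Local Open Scope ring_scope.

Lemma linear_sum (K : fieldType) (U W : lmodType K) (h : U -> W) n
    (a : 'I_n -> K) (u : 'I_n -> U) :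
  linear h -> h (\sum_i a i *: u i) = \sum_i a i *: h (u i).
Proof.
move=> h_lin; have h0 : h 0 = 0.
  by rewrite -[X in h X](subrr (0 : U)) addrC -scaleN1r h_lin scaleN1r addNr.
elim: n a u => [|n IH] a u; first by rewrite !big_ord0.
by rewrite !big_ord_recl h_lin IH.
Qed.

(** With [F j i] standing for d_j d_i, the term (j, i) with [i < j] cancels the term (i, j-1): their
    values agree and their index sums differ by one. *)
Lemma cosimplicial_sum (K : fieldType) (V : lmodType K) (n : nat)
    (F : nat -> nat -> V) :
  (forall i j, (i < j <= n)%N -> F j i = F i j.-1) ->
  \sum_(j < n.+1) (-1) ^+ j *: (\sum_(i < n) (-1) ^+ i *: F j i) = 0.
Proof.
move=> hF.
pose G j i := (-1) ^+ (j + i) *: F j i.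
have E (j : 'I_n.+1) : (-1) ^+ j *: (\sum_(i < n) (-1) ^+ i *: F j i) =
    \sum_(i < n | (j <= i)%N) G j i + \sum_(i < n | (i < j)%N) G j i.
  rewrite scaler_sumr (bigID (fun i : 'I_n => (j <= i)%N)) /=.
  congr (_ + _); first by apply: eq_bigr => i _; rewrite scalerA -exprD.
  by apply: eq_big => [i|i _]; rewrite ?ltnNge // scalerA -exprD.
rewrite (eq_bigr _ (fun j _ => E j)) big_split /=.
(* The row [j = n] has no [i >= j] and the row [j = 0] no [i < j]. Without them both halves have [n]
   rows, the second one shifted by one. *)
rewrite big_ord_recr /= [X in _ + X + _]big1 ?addr0; last first.
  by move=> i; rewrite leqNgt ltn_ord.
rewrite [X in _ + X]big_ord_recl /= [X in _ + (X + _)]big_pred0 // add0r.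
(* Exchanging the sums in the first half only makes, for each [i], the terms (j, i) with [j <= i]
   face the terms (i+1, j). *)
rewrite (exchange_big_dep predT) //= -big_split big1 //= => i _.
rewrite -[X in _ + X]opprK; apply/eqP; rewrite subr_eq0; apply/eqP.
rewrite -sumrN; apply: eq_big => [j|j lej]; first by rewrite ltnS.
rewrite /G /bump /= add1n [F i.+1 j]hF ?ltnS ?lej ?ltn_ord //.
by rewrite /= addSn exprS mulN1r scaleNr opprK addnC.
Qed.

Section Cofaces.
Variables (K : fieldType) (V : lmodType K) (m : {linear tpow V 3 -> V}).
Implicit Types (s t : seq V) (g : seq V -> V).

Definition contract i s :=
  take i.*2 s ++ m (tensor 3 (take 3 (drop i.*2 s))) :: drop i.*2.+3 s.

(** Here [g] is any function on lists, in practice a cochain composed with [tensor]. A coface is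
    again such a function, so cofaces iterate without a proof of multilinearity at each stage. *)
Definition coface p g j s : V :=
  if j == 0%N then m (tensor 3 (rcons (take 2 s) (g (drop 2 s))))
  else if j == p.+1 then m (tensor 3 (g (take p.*2.-1 s) :: drop p.*2.-1 s))
  else g (contract j.-1 s).

Lemma contract0 a b c s :
  contract 0 [:: a, b, c & s] = m (tensor 3 [:: a; b; c]) :: s.
Proof. by rewrite /contract /= take0 drop0. Qed.

Lemma contractS i a b s : contract i.+1 [:: a, b & s] = [:: a, b & contract i s].
Proof. by []. Qed.

Lemma contract_catl i s t :
  (i.*2.+3 <= size s)%N -> contract i (s ++ t) = contract i s ++ t.
Proof.
elim: i s => [|i IH] [|a [|b [|c s]]] // lt.
  by rewrite (contract0 a b c (s ++ t)) contract0.
by rewrite (contractS i a b (c :: s ++ t)) contractS -cat_cons IH.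
Qed.

Lemma contract_catr i s t :
  size s = i.*2 -> contract i (s ++ t) = s ++ contract 0 t.
Proof.
elim: i s => [|i IH] [|a [|b s]] //= [sz].
by rewrite contractS IH.
Qed.

Lemma size_contract i s :
  (i.*2.+3 <= size s)%N -> size (contract i s) = (size s).-2.
Proof. by move=> lt; rewrite size_cat /= size_takel ?size_drop; lia. Qed.

Lemma delta_val_coface p (f : cochain V p) s :
  delta_val m f s =
    \sum_(j < p.+2) (-1) ^+ j *: coface p (f \o tensor p.*2.-1) j s.
Proof.
rewrite big_ord_recl big_ord_recr /= /coface /= /bump /= !add1n eqxx.
rewrite expr0 scale1r addrA; congr (_ + _ + _); apply: eq_bigr => i _.
by rewrite add1n eqSS ltn_eqF.
Qed.

(** This restriction on lengths is what [delta_tensor] requires: it evaluates [delta] only on lists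
    of the right size. *)
Lemma eq_coface p g h j s : (0 < p)%N -> size s = p.*2.+1 -> (j <= p.+1)%N ->
  (forall t, size t = p.*2.-1 -> g t = h t) -> coface p g j s = coface p h j s.
Proof.
move=> p_gt0 sz lej gh; rewrite /coface.
case: eqP => [_|j0]; first by rewrite gh // size_drop; lia.
case: eqP => [_|jp]; first by rewrite gh // size_takel; lia.
by rewrite gh // size_contract; lia.
Qed.

(** The value of [g] enters each coface linearly, so an outer coface passes through the alternating
    sum of an inner differential. *)
Lemma coface_sum p n (a : 'I_n -> K) (g : 'I_n -> seq V -> V) j s :
  coface p (fun t => \sum_i a i *: g i t) j s =
    \sum_i a i *: coface p (g i) j s.
Proof.
rewrite /coface; case: eqP => _.
  apply: (@linear_sum _ _ _ (fun u => m (tensor 3 (rcons (take 2 s) u)))).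
  apply: lin_comp => b u v; rewrite -!cats1; apply: tensor_cat_lin.
  by rewrite size_take_min ltnS geq_minl.
case: eqP => // _.
apply: (@linear_sum _ _ _ (fun u => m (tensor 3 (u :: drop p.*2.-1 s)))).
by apply: lin_comp => b u v; apply: (@tensor_cat_lin _ _ 3 [::]).
Qed.

Hypothesis m_assoc : weak_totally_associative m.

Lemma contract_contract i j s : (i <= j)%N -> (j.*2 + 5 <= size s)%N ->
  contract i (contract j.+1 s) = contract j (contract i s).
Proof.
elim: i j s => [|i IH] [|j] [|a [|b [|c [|d [|e s]]]]] // leij sz.
all: rewrite /= in leij sz; try by lia.
(* In the overlapping case [i = j = 0], the two contractions bracket the first five entries in the
   two ways that associativity equates. *)
- by rewrite contractS !contract0 m_assoc.
by rewrite (contractS j.+1) !(contractS i) (contractS j a b) IH //=; lia.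
Qed.

Lemma coface_last p g t u : size t = p.*2.-1 ->
  coface p g p.+1 (t ++ u) = m (tensor 3 (g t :: u)).
Proof.
by move=> sz; rewrite /coface /= eqxx take_size_cat // drop_size_cat.
Qed.

Lemma coface0 p g a b s :
  coface p g 0 [:: a, b & s] = m (tensor 3 [:: a; b; g s]).
Proof. by rewrite /coface /= take0 drop0. Qed.

Lemma coface_mid p g i s : (i < p)%N -> coface p g i.+1 s = g (contract i s).
Proof. by move=> ltip; rewrite /coface /= eqSS ltn_eqF. Qed.

(** Operations on disjoint blocks commute outright. Associativity settles two neighbouring inner
    contractions and the pairs (0, 1), (0, p+2) and (p+1, p+2), where [g] supplies one argument of
    [m]. *)
Lemma coface_coface p g i j s : (0 < p)%N -> size s = p.*2.+3 ->
    (i < j <= p.+2)%N ->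
  coface p.+1 (coface p g i) j s = coface p.+1 (coface p g j.-1) i s.
Proof.
move=> p_gt0 sz /andP[]; case: j => // j; rewrite ltnS => leij lejp /=.
move: lejp; rewrite ltnS leq_eqVlt => /orP[/eqP ej | ltjp]; last first.
- rewrite coface_mid //; case: i leij => [_|i ltij]; last first.
    rewrite coface_mid; last by lia.
    case: j ltij ltjp => // j leij ltjp.
    rewrite !coface_mid ?contract_contract //; lia.
  case: s sz => [|a [|b [|c [|d [|e s]]]]] //= sz; try lia.
  case: j ltjp => [|j] ltjp; last by rewrite contractS !coface0 coface_mid.
  by rewrite contract0 !coface0 m_assoc.
rewrite {j}ej in leij *.
(* For the last outer coface, the final two entries [y], [z] are split off as the right arguments of
   [m]. *)
rewrite -(cat_take_drop p.*2.+1 s).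
have szt : size (take p.*2.+1 s) = p.*2.+1 by rewrite size_takel ?sz; lia.
have: size (drop p.*2.+1 s) = 2 by rewrite size_drop sz; lia.
move: (take _ s) (drop _ s) szt => {s sz} t [|y [|z []]] // szt _.
rewrite coface_last //.
case: i leij => [_|i]; last rewrite ltnS leq_eqVlt => /orP[/eqP -> | ltip].
- case: t szt => [|a [|b t]] //= [szt]; first by lia.
  by rewrite !coface0 coface_last -?m_assoc //; lia.
- rewrite -(cat_take_drop p.*2.-1 t).
  have szu : size (take p.*2.-1 t) = p.*2.-1 by rewrite size_takel ?szt; lia.
  have: size (drop p.*2.-1 t) = 2 by rewrite size_drop szt; lia.
  move: (take _ t) (drop _ t) szu => {t szt} u [|w [|x []]] // szu _.
  rewrite coface_last // coface_mid //.
  (* Since [u] has odd length 2p-1, [w] must join it before contraction [p] can act on exactly [x],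
     [y], [z]. *)
  rewrite -catA -[u ++ _]cat_rcons contract_catr; last by rewrite size_rcons; lia.
  by rewrite contract0 cat_rcons !coface_last -?m_assoc.
rewrite coface_mid // [RHS]coface_mid; last by lia.
rewrite contract_catl ?szt; last by lia.
by rewrite coface_last // size_contract szt; lia.
Qed.

Lemma delta_delta_tensor p (f : cochain V p) s : (0 < p)%N ->
  size s = p.*2.+3 -> delta m (delta m f) (tensor p.*2.+3 s) = 0.
Proof.
move=> p_gt0 sz; rewrite (@delta_tensor _ _ _ p.+1) // delta_val_coface.
pose g := f \o tensor p.*2.-1.
(* Writing 0 as the vanishing double sum allows a comparison term by term in the outer index. *)
rewrite -[RHS](@cosimplicial_sum _ V p.+2
  (fun j i => coface p.+1 (coface p g i) j s)); last first.
  by move=> i j ltij; apply: coface_coface.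
apply: eq_bigr => j _; congr (_ *: _); rewrite -coface_sum.
apply: eq_coface => // [|t szt]; first exact: leq_ord.
by rewrite /= delta_tensor // delta_val_coface.
Qed.

End Cofaces.

Theorem proposition3p4 (K : closedFieldType) (char0 : [pchar K] =i pred0)
    (V : lmodType K) (m : {linear tpow V 3 -> V})
    (m_assoc : weak_totally_associative m) :
  forall p : nat, (1 <= p)%N ->
  forall f : cochain V p, delta m (delta m f) =1 \0.
Proof.
(* Linear maps on a tensor power are determined by pure tensors, hence by their values on lists. *)
move=> p p_gt0 f; apply: tpow_ext => x.
by rewrite pureE delta_delta_tensor ?size_tuple.
Qed.
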